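(* The set $\mathcal{S}_1(6) \cap (1/3, 1/2]$ contains the set $\{1/3 + 1/(6p) : p \in \mathrm{Prog}(6, 11)\}$.
   Context: For $x=(x_1,\ldots,x_n) \in (\mathbb{R}/\mathbb{Z})^n$ let $D(x):=\max_k \|x_k-1/2\|$, where $\|\cdot\|$ denotes distance to the nearest integer; for a closed subset $S$ let $D(S):=\min_{x \in S} D(x)$. A subtorus of $(\mathbb{R}/\mathbb{Z})^n$ is a closed connected subgroup; it is proper if it is not contained in the union of the coordinate hyperplanes $\{x_i=0\}$. $\mathcal{S}_1(n)$ is the set of values $D(T)$ as $T$ ranges over the $1$-dimensional proper subtori of $(\mathbb{R}/\mathbb{Z})^n$. $\mathrm{Prog}(\alpha,\beta):=\{\alpha s+\beta : s \in \mathbb{Z}_{\geq 0}\}$. *)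

(* Defs.v *)
From HB Require Import structures.
From mathcomp Require Import all_boot all_order all_algebra.
From mathcomp Require Import generic_quotient ring_quotient.
From mathcomp Require Import all_classical all_reals all_analysis.
Import Order.TTheory GRing.Theory Num.Theory numFieldNormedType.Exports.

Set Implicit Arguments.
Unset Strict Implicit.
Unset Printing Implicit Defensive.

Local Open Scope classical_set_scope.
Local Open Scope ring_scope.
Local Open Scope quotient_scope.

Section Circle.
Context (R : realType).

Local Notation Zsub := (GRing.ZmodClosed.clone R (@Num.int_num_subdef R) _).
Local Notation RmodZ := (Quotient.quot Zsub).

(* R/Z with the quotient topology.  The group structure is rebuilt with the
   operations of [Quotient.quot] because [quotient_topology] and
   [Quotient.quot] carry different choice structures. *)
Definition circle : Type := quotient_topology RmodZ.

HB.instance Definition _ := Topological.on circle.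
HB.instance Definition _ := Quotient.on circle.

Fact circle_pi_eq (x y : R) :
  (\pi_circle x == \pi_circle y) = Quotient.equiv Zsub x y.
Proof. by rewrite Quotient.equivE Quotient.idealrBE; apply/eqP/eqP. Qed.

HB.instance Definition _ :=
  isEqQuotient.Build R (Quotient.equiv Zsub) circle circle_pi_eq.

HB.instance Definition _ := GRing.isZmodule.Build circle
  (@Quotient.addqA R Zsub) (@Quotient.addqC R Zsub)
  (@Quotient.add0q R Zsub) (@Quotient.addNq R Zsub).

HB.instance Definition _ :=
  @isZmodQuotient.Build R (Quotient.equiv Zsub) 0 -%R +%R circle
    (lock _) (@Quotient.pi_opp R Zsub) (@Quotient.pi_add R Zsub).

End Circle.

(* (R/Z)^n with the product topology and the pointwise group structure *)
Definition torus (R : realType) (n : nat) : Type :=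
  prod_topology (fun _ : 'I_n => circle R).

HB.instance Definition _ (R : realType) n := Topological.on (torus R n).
HB.instance Definition _ (R : realType) n :=
  GRing.Zmodule.copy (torus R n) ('I_n -> circle R).

Section Loneliness.
Context (R : realType) (n : nat).
Implicit Types (x : torus R n) (T : set (torus R n)).

Definition subtorus T :=
  [/\ GRing.zmod_closed (mem T), closed T & connected T].

(* T is isomorphic, as a topological group, to (R/Z)^d *)
Definition torus_dim (d : nat) T :=
  exists (f : torus R d -> torus R n) (g : torus R n -> torus R d),
    [/\ zmod_morphism f, continuous f, range f = T,
        cancel f g & {within T, continuous g}].

Definition proper_subtorus T :=
  subtorus T /\ ~ (T `<=` \bigcup_(i : 'I_n) [set x | x i = 0]).

Definition dist_int (y : circle R) : R :=
  inf (range (fun m : int => `|repr y - m%:~R|)).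

(* All the distances are nonnegative, so the default value 0 of the maximum
   plays a role only when n = 0. *)
Definition D x : R :=
  \big[Num.max/0]_(k < n) dist_int (x k - \pi_(circle R) 2^-1).

(* D(T) = v *)
Definition min_D T (v : R) := (D @` T) v /\ lbound (D @` T) v.

End Loneliness.

Definition spectrum (R : realType) (d n : nat) : set R :=
  [set v | exists T : set (torus R n),
    [/\ proper_subtorus T, torus_dim d T & min_D T v]].
Arguments spectrum R d n : clear implicits.

Definition Prog (a b : nat) : set nat := range (fun s : nat => a * s + b)%N.

(* Main.v *)
(** For p = 6s + 5 the value 1/3 + 1/(6p) is realised by the closed curve
    t |-> (6, p - 12, p - 6, p, p + 6, 2p - 6) t.  Put x = 6t, y = pt, so the
    coordinates are x, y - 2x, y - x, y, y + x, 2y - x.  The points (x, y) of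
    the 2-torus at which all six are farther than 1/6 - 1/(6p) from the
    integers form twelve small open triangles shrinking to points such as
    (1/6, 1/2), and on each of them px - 6y lies strictly between two
    consecutive integers, while px - 6y is an integer along the curve. *)
From HB Require Import structures.
Require Import Defs.
From mathcomp Require Import all_boot all_order all_algebra.
From mathcomp Require Import generic_quotient ring_quotient.
From mathcomp Require Import all_classical all_reals all_analysis.
From mathcomp Require Import zify ring lra.
Import Order.TTheory GRing.Theory Num.Theory numFieldNormedType.Exports.

Set Implicit Arguments.
Unset Strict Implicit.
Unset Printing Implicit Defensive.

Local Open Scope classical_set_scope.
Local Open Scope ring_scope.
Local Open Scope quotient_scope.

(** * Topology and group structure of the circle *)

Definition circle_pi (R : realType) (x : R) : circle R := \pi_(circle R) x.
Arguments circle_pi {R} x.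

Lemma circle_pi_is_zmod_morphism (R : realType) : zmod_morphism (@circle_pi R).
Proof. exact: pi_is_zmod_morphism. Qed.

HB.instance Definition _ (R : realType) :=
  GRing.isZmodMorphism.Build R (circle R) (@circle_pi R) (@circle_pi_is_zmod_morphism R).

Lemma circle_piK (R : realType) (y : circle R) : circle_pi (repr y) = y.
Proof. exact: reprK. Qed.

Lemma circle_pi_eqP (R : realType) (x y : R) :
  circle_pi x = circle_pi y <-> exists m : int, x = y + m%:~R.
Proof.
have -> : (circle_pi x = circle_pi y) <-> (x - y \is a Num.int).
  rewrite /circle_pi; split => [/eqP|h]; last apply/eqP.
    by rewrite circle_pi_eq Quotient.equivE.
  by rewrite circle_pi_eq Quotient.equivE.
split=> [/intrP[m e]|[m ->]]; first by exists m; rewrite -e addrC subrK.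
by rewrite addrC addKr.
Qed.

Lemma circle_pi_mulrz (R : realType) (x : R) (n : int) :
  circle_pi x *~ n = circle_pi (n%:~R * x).
Proof. by rewrite -raddfMz mulrzl. Qed.

Lemma circle_pi_continuous (R : realType) : continuous (@circle_pi R).
Proof. exact: pi_continuous. Qed.

Lemma circle_continuous (R : realType) (X : topologicalType) (f : circle R -> X) :
  continuous (f \o @circle_pi R) -> continuous f.
Proof. by move=> h; apply/quotient_continuous. Qed.

(** The saturation of [U] is the union of its integer translates, all open. *)
Lemma circle_pi_open (R : realType) (U : set R) : open U -> open (@circle_pi R @` U).
Proof.
move=> oU; suff : open (@circle_pi R @^-1` (@circle_pi R @` U)) by [].
have -> : @circle_pi R @^-1` (@circle_pi R @` U) =
    \bigcup_(m : int) ((fun x => x + m%:~R) @^-1` U).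
  apply/seteqP; split=> x /=.
    by move=> [y Uy /circle_pi_eqP [m e]]; exists m => //=; rewrite -e.
  by move=> [m _ /= Um]; exists (x + m%:~R) => //; apply/circle_pi_eqP; exists m.
apply: bigcup_open => m _; apply: open_comp => // x _.
by apply: cvgD; [exact: cvg_id|exact: cvg_cst].
Qed.

(** Subtraction is continuous at representatives in [R], and the open map [circle_pi] carries the
    neighbourhoods down to the circle. *)
Lemma circle_sub_continuous (R : realType) (X : topologicalType) (f g : X -> circle R) :
  continuous f -> continuous g -> continuous (fun x => f x - g x).
Proof.
move=> cf cg x W.
set a := repr (f x); set b := repr (g x).
have -> : f x - g x = circle_pi (a - b) by rewrite raddfB /= !circle_piK.
move=> /circle_pi_continuous W1.
have : (fun z : R * R => z.1 - z.2) @ (a, b) --> (a - b).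
  by apply: cvgB; [exact: cvg_fst|exact: cvg_snd].
move=> /(_ _ W1) [[A B] [/= nA nB] AB].
have cA : \forall y \near x, (circle_pi @` A^°) (f y).
  apply: cf; apply: open_nbhs_nbhs; split; first exact/circle_pi_open/open_interior.
  by exists a => //; exact: circle_piK.
have cB : \forall y \near x, (circle_pi @` B^°) (g y).
  apply: cg; apply: open_nbhs_nbhs; split; first exact/circle_pi_open/open_interior.
  by exists b => //; exact: circle_piK.
suff : \forall y \near x, W (f y - g y) by []; near=> y.
have [u /interior_subset Au <-] : (circle_pi @` A^°) (f y) by near: y.
have [v /interior_subset Bv <-] : (circle_pi @` B^°) (g y) by near: y.
by rewrite -raddfB; exact: (AB (u, v)).
Unshelve. all: by end_near. Qed.

Lemma circle_mulrz_continuous (R : realType) (n : int) :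
  continuous (fun y : circle R => y *~ n).
Proof.
apply: circle_continuous => x; rewrite /comp.
have -> : (fun x : R => circle_pi x *~ n) = @circle_pi R \o (fun x => n%:~R * x).
  by apply/funext => u; exact: circle_pi_mulrz.
apply: continuous_comp; last exact: circle_pi_continuous.
by apply: cvgM; [exact: cvg_cst|exact: cvg_id].
Qed.

(** A non-integer lies in the open interval between its floor and the next integer, which contains
    no integer. *)
Lemma circle_closed0 (R : realType) : closed [set (0 : circle R)].
Proof.
rewrite -openC; suff : open (@circle_pi R @^-1` (~` [set 0])) by [].
rewrite openE => x /= x0; rewrite /interior.
have hx : (Num.floor x)%:~R < x.
  rewrite lt_neqAle floor_le_tmp andbT; apply/eqP => e; apply: x0.
  rewrite -(raddf0 (@circle_pi R)); apply/circle_pi_eqP.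
  by exists (Num.floor x); rewrite add0r.
have : nbhs x [set` `](Num.floor x)%:~R, ((Num.floor x + 1)%:~R : R)[].
  by apply: open_nbhs_nbhs; split; [exact: itv_open|rewrite /= in_itv/= hx floorD1_gt].
apply: filterS => y; rewrite /= in_itv /= -(raddf0 (@circle_pi R)) => + /circle_pi_eqP [m].
by rewrite add0r => /[swap] -> ; rewrite !ltr_int; lia.
Qed.

(** * Continuous maps into and out of the torus *)

Lemma torus_continuous (R : realType) (n : nat) (X : topologicalType)
    (f : X -> torus R n) :
  (forall k, continuous (fun x => f x k)) -> continuous f.
Proof.
move=> h x; apply/cvg_sup => k; move: x.
apply/(@continuousP _ (initial_topology (@^~ k))) => A [B oB <-].
exact: (open_comp (f := f ^~ k)) (fun x _ => h k x) oB.
Qed.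

Lemma torus_proj_continuous (R : realType) (n : nat) (k : 'I_n) :
  continuous (fun z : torus R n => z k).
Proof. exact: (@proj_continuous _ (fun _ : 'I_n => circle R)). Qed.

Lemma torus_sum_continuous (R : realType) (X : topologicalType) (I : Type) (r : seq I)
    (F : I -> X -> circle R) :
  (forall i, continuous (F i)) -> continuous (fun x => \sum_(i <- r) F i x).
Proof.
move=> cF; elim: r => [|i r IH].
  by under eq_fun do rewrite big_nil; move=> x; exact: cvg_cst.
(* Continuity is available for differences, so a + b is treated as a - (0 - b). *)
under eq_fun do rewrite big_cons -[X in _ + X]opprK.
apply: circle_sub_continuous => //.
under eq_fun do rewrite -[X in - X]subr0 opprB.
by apply: circle_sub_continuous => // x; exact: cvg_cst.
Qed.

(** * Closed curves through 0 as one-dimensional subtori *)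

Definition winding (R : realType) (n : nat) (w : 'I_n -> int)
    (y : circle R) : torus R n :=
  fun k => y *~ w k.

Section Winding.
Context (R : realType) (n : nat) (w u : 'I_n -> int).
Context (bezout : \sum_k u k * w k = 1).

(** By the Bezout relation this character is a continuous left inverse of the winding, which is thus
    an embedding. *)
Let unwind (z : torus R n) : circle R := \sum_k z k *~ u k.

Let windingK : cancel (@winding R n w) unwind.
Proof.
move=> y; rewrite /unwind /winding.
under eq_bigr do rewrite -mulrzA mulrC.
by rewrite -mulrz_sumr bezout.
Qed.

Let unwind_continuous : continuous unwind.
Proof.
apply: torus_sum_continuous => k z.
apply: (@continuous_comp _ _ _ (fun z : torus R n => z k) (fun y => y *~ u k)).
  exact: torus_proj_continuous.
exact: circle_mulrz_continuous.
Qed.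

Let winding_continuous : continuous (@winding R n w).
Proof. by apply: torus_continuous => k; exact: circle_mulrz_continuous. Qed.

(** Closed, as the solution set of the equations [z k = unwind z *~ w k]; connected, as a continuous
    image of the line. *)
Lemma winding_subtorus : subtorus (range (@winding R n w)).
Proof.
split.
- split=> [|x y].
    by apply: mem_set; exists 0 => //; apply/funext => k; rewrite /winding mul0rz.
  move=> /set_mem[a _ <-] /set_mem[b _ <-]; apply: mem_set; exists (a - b) => //.
  by apply/funext => k; rewrite /winding mulrzBl.
- have -> : range (@winding R n w) =
      \bigcap_(k in setT) ((fun z : torus R n => z k - unwind z *~ w k) @^-1` [set 0]).
    apply/seteqP; split=> [_ [y _ <-] k _ /=|z zk].
      by rewrite windingK subrr.
    by exists (unwind z) => //; apply/funext => k; apply/esym/subr0_eq/zk.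
  apply: closed_bigI => k _; apply: closed_comp (@circle_closed0 R) => z _.
  apply: circle_sub_continuous; first exact: torus_proj_continuous.
  move=> {}z; apply: (@continuous_comp _ _ _ unwind (fun y => y *~ w k)).
    exact: unwind_continuous.
  exact: circle_mulrz_continuous.
- have -> : range (@winding R n w) = (@winding R n w \o @circle_pi R) @` setT.
    apply/seteqP; split=> [_ [y _ <-]|_ [t _ <-]]; last by exists (circle_pi t).
    by exists (repr y) => //=; rewrite circle_piK.
  apply: connected_continuous_connected; first exact/connected_intervalP.
  apply: continuous_subspaceT => t.
  by apply: continuous_comp; [exact: circle_pi_continuous|exact: winding_continuous].
Qed.

Lemma winding_dim1 : torus_dim 1 (range (@winding R n w)).
Proof.
exists (fun y => winding w (y ord0)), (fun z _ => unwind z); split.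
- by move=> x y; apply/funext => k; rewrite /winding mulrzBl.
- move=> y; apply: (@continuous_comp _ _ _ (fun y : torus R 1 => y ord0)).
    exact: torus_proj_continuous.
  exact: winding_continuous.
- apply/seteqP; split=> [_ [y _ <-]|_ [y _ <-]]; first by exists (y ord0).
  by exists (fun=> y).
- by move=> y; apply/funext => k; rewrite windingK (ord1 k).
- by apply: continuous_subspaceT; apply: torus_continuous.
Qed.

End Winding.

(** * Distance to the integers, and [D] along a winding *)

Lemma dist_int_le (R : realType) (x : R) (m : int) :
  dist_int (circle_pi x) <= `|x - m%:~R|.
Proof.
have /circle_pi_eqP[a e] := circle_piK (circle_pi x).
apply: ge_inf; first by exists 0 => _ [k _ <-].
by exists (m + a) => //; rewrite e rmorphD/=; congr `|_|; ring.
Qed.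

Lemma dist_int_ge (R : realType) (x v : R) :
  (forall m : int, v <= `|x - m%:~R|) -> v <= dist_int (circle_pi x).
Proof.
move=> h; have /circle_pi_eqP[a e] := circle_piK (circle_pi x).
apply: lb_le_inf; first by exists `|repr (circle_pi x) - 0%:~R|, 0.
move=> _ [m _ <-]; rewrite e.
by have := h (m - a); rewrite rmorphB/= opprB addrA addrAC.
Qed.

Lemma D_windingE (R : realType) (n : nat) (w : 'I_n -> int) (t : R) :
  D (winding w (circle_pi t)) =
  \big[Num.max/0]_(k < n) dist_int (circle_pi ((w k)%:~R * t - 2^-1)).
Proof.
by apply: eq_bigr => k _; rewrite /winding circle_pi_mulrz -raddfB.
Qed.

(** A coordinate near an integer is far from 1/2: half-integers have absolute value at least 1/2,
    and the triangle inequality does the rest. *)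
Lemma D_winding_ge (R : realType) (n : nat) (w : 'I_n -> int) (t v : R) k (m : int) :
  `|(w k)%:~R * t - m%:~R| <= 2^-1 - v -> v <= D (winding w (circle_pi t)).
Proof.
move=> h; rewrite D_windingE; apply: le_trans (le_bigmax _ _ k).
apply: dist_int_ge => a.
have : 2^-1 <= `|(m - a)%:~R - 2^-1| :> R.
  have [le|lt] := leP (m - a) 0.
    have : (m - a)%:~R <= 0 :> R by rewrite -[0]/(0%:~R) ler_int.
    by move=> ?; rewrite ler0_norm; lra.
  have : 1 <= (m - a)%:~R :> R by rewrite -[1]/(1%:~R) ler_int; lia.
  by move=> ?; rewrite ger0_norm; lra.
have -> : (m - a)%:~R - 2^-1 =
    ((w k)%:~R * t - 2^-1 - a%:~R) - ((w k)%:~R * t - m%:~R) :> R.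
  by rewrite rmorphB/=; ring.
by move=> /le_trans/(_ (ler_normB _ _)); lra.
Qed.

Lemma D_winding_le (R : realType) (n : nat) (w : 'I_n -> int) (t v : R) : 0 <= v ->
  (forall k, exists m : int, `|(w k)%:~R * t - 2^-1 - m%:~R| <= v) ->
  D (winding w (circle_pi t)) <= v.
Proof.
move=> v0 h; rewrite D_windingE; apply: bigmax_le => // k _.
by have [m] := h k; apply: le_trans; exact: dist_int_le.
Qed.

(** * Triangles in the plane that miss the lattice lines *)

Lemma ltr_int_pM2l (F : realDomainType) (q : F) (a b : int) :
  0 < q -> q * a%:~R < q * b%:~R -> a < b.
Proof. by move=> q0; rewrite ltr_pM2l// ltr_int. Qed.

(** As p - 5 = 6s, the two bounds are 6p(as + b) and 6p(as + b + 1). *)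
Lemma between_consecutive_multiples (F : realFieldType) (s a b l : int) (p X : F) :
  0 < p -> p = 6 * s%:~R + 5 ->
  p * (a%:~R * (p - 5) + 6 * b%:~R) < X ->
  X < p * (a%:~R * (p - 5) + 6 * b%:~R + 6) -> X <> 6 * p * l%:~R.
Proof.
move=> p0 ps + + E; have -> : p - 5 = 6 * s%:~R by rewrite ps addrK.
have -> : p * (a%:~R * (6 * s%:~R) + 6 * b%:~R) = 6 * p * (a * s + b)%:~R.
  by rewrite rmorphD rmorphM/=; ring.
have -> : p * (a%:~R * (6 * s%:~R) + 6 * b%:~R + 6) = 6 * p * (a * s + b + 1)%:~R.
  by rewrite !rmorphD rmorphM/=; ring.
have q0 : 0 < 6 * p by rewrite mulr_gt0.
by rewrite E => /(ltr_int_pM2l q0) + /(ltr_int_pM2l q0); lia.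
Qed.

(* Here A = 6 p x and B = 6 p y, and n1, n2, n3, n4 are the integer parts of
   y - 2x, y - x, y + x, 2y - x, for x and y in (0, 1). *)
Lemma no_lattice_point (F : realFieldType) (s : int) (p A B : F) (n1 n2 n3 n4 l : int) :
  p = 6 * s%:~R + 5 -> 11 <= p ->
  p - 1 < A < 5 * p + 1 -> p - 1 < B < 5 * p + 1 ->
  p - 1 < B - 2 * A - 6 * p * n1%:~R < 5 * p + 1 ->
  p - 1 < B - A - 6 * p * n2%:~R < 5 * p + 1 ->
  p - 1 < B + A - 6 * p * n3%:~R < 5 * p + 1 ->
  p - 1 < 2 * B - A - 6 * p * n4%:~R < 5 * p + 1 ->
  p * A - 6 * B <> 6 * p * l%:~R.
Proof.
move=> ps p11 /andP[A1 A2] /andP[B1 B2] /andP[h1 h1'] /andP[h2 h2'].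
move=> /andP[h3 h3'] /andP[h4 h4'].
have p0 : 0 < p by apply: lt_le_trans p11.
have q0 : 0 < 6 * p by rewrite mulr_gt0.
(* Crude bounds from the ranges of [A] and [B] leave 3 * 2 * 2 * 3 = 36 cases, of which 24 are
   linearly contradictory. *)
have c1 : -3 < n1 < 1.
  apply/andP; split; apply: (ltr_int_pM2l q0).
    by clear - p11 A2 B1 h1'; lra.
  by clear - p11 A1 B2 h1; lra.
have c2 : -2 < n2 < 1.
  apply/andP; split; apply: (ltr_int_pM2l q0).
    by clear - p11 A2 B1 h2'; lra.
  by clear - p11 A1 B2 h2; lra.
have c3 : -1 < n3 < 2.
  apply/andP; split; apply: (ltr_int_pM2l q0).
    by clear - p11 A1 B1 h3'; lra.
  by clear - p11 A2 B2 h3; lra.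
have c4 : -2 < n4 < 2.
  apply/andP; split; apply: (ltr_int_pM2l q0).
    by clear - p11 A2 B1 h4'; lra.
  by clear - p11 A1 B2 h4; lra.
have v1 : n1 = -2 \/ n1 = -1 \/ n1 = 0 by move: c1; clear; lia.
have v2 : n2 = -1 \/ n2 = 0 by move: c2; clear; lia.
have v3 : n3 = 0 \/ n3 = 1 by move: c3; clear; lia.
have v4 : n4 = -1 \/ n4 = 0 \/ n4 = 1 by move: c4; clear; lia.
have tight (a b : int) :=
  @between_consecutive_multiples F s a b l p (p * A - 6 * B) p0 ps.
clear c1 c2 c3 c4 q0 p0 ps.
move: h1 h1' h2 h2' h3 h3' h4 h4'.
case: v1 => [|[|]] ->; case: v2 => [|] ->;
case: v3 => [|] ->; case: v4 => [|[|]] -> => h1 h1' h2 h2' h3 h3' h4 h4'.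
all: try (by exfalso; lra).
(* In each of the twelve remaining cases the constraints cut out a triangle, and
   the two bounds required by [tight] follow from combinations of them whose
   coefficients are affine in p and nonnegative for p >= 11; hence the products
   with p - 11, after which everything is linear in the monomials. *)
all: have M (u v : F) (h : u < v) : 0 <= (v - u) * (p - 11)
  by rewrite mulr_ge0 ?subr_ge0// ltW.
all: have := M _ _ A1; have := M _ _ A2; have := M _ _ B1; have := M _ _ B2.
all: have := M _ _ h1; have := M _ _ h1'; have := M _ _ h2; have := M _ _ h2'.
all: have := M _ _ h3; have := M _ _ h3'; have := M _ _ h4; have := M _ _ h4'.
all: clear M => ? ? ? ? ? ? ? ? ? ? ? ?.
(* For a triangle shrinking to (x0, y0), a = 6 x0 and b is the floor of 5 x0 - 6 y0, because p x0 -
   6 y0 = 6 x0 s + 5 x0 - 6 y0. Here (x0, y0) = (2/3, 1/6). *)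
- by apply: (tight 4 2); lra.
- by apply: (tight 5 2); lra.
- by apply: (tight 5 1); lra.
- by apply: (tight 3 1); lra.
- by apply: (tight 3 0); lra.
- by apply: (tight 4 0); lra.
- by apply: (tight 2 (-2)); lra.
- by apply: (tight 3 (-2)); lra.
- by apply: (tight 3 (-3)); lra.
- by apply: (tight 1 (-3)); lra.
- by apply: (tight 1 (-4)); lra.
- by apply: (tight 2 (-4)); lra.
Qed.

(** * The curve for p = 6s + 5: lower bound and minimiser *)

Definition speed (p : int) (k : 'I_6) : int :=
  nth 0 [:: 6; p - 12; p - 6; p; p + 6; 2 * p - 6] k.

(** The speeds 6 and p suffice: 6(s + 1) - p = 1. *)
Lemma speed_bezout (s : int) :
  \sum_(k < 6) nth 0 [:: s + 1; 0; 0; -1; 0; 0] k * speed (6 * s + 5) k = 1.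
Proof. by rewrite !big_ord_recl big_ord0 /speed /=; ring. Qed.

(** Only the two integers around [x] matter; scaling by 6p turns 1/6 - 1/(6p) into p - 1. *)
Lemma far_from_integers (R : realType) (p x : R) : 0 < p ->
  (forall m : int, 6^-1 - (6 * p)^-1 < `|x - m%:~R|) ->
  p - 1 < 6 * p * (x - (Num.floor x)%:~R) < 5 * p + 1.
Proof.
move=> p0 h; have q0 : 0 < 6 * p by rewrite mulr_gt0.
have e : 6 * p * (6^-1 - (6 * p)^-1) = p - 1 by field; rewrite gt_eqF.
have := h (Num.floor x); rewrite ger0_norm ?subr_ge0 ?floor_le_tmp//.
rewrite -(ltr_pM2l q0) e => h1.
have := h (Num.floor x + 1); rewrite ltr0_norm ?subr_lt0 ?floorD1_gt//.
rewrite -(ltr_pM2l q0) e rmorphD/= => h2.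
by apply/andP; split; lra.
Qed.

(** Gives the lower bound on [D] along the whole curve. Otherwise the fractional parts of 6t and pt
    would form a point excluded by [no_lattice_point]. *)
Lemma near_integer (R : realType) (s : int) (t : R) : 1 <= s ->
  let p := 6 * s%:~R + 5 in
  exists k, exists m : int,
    `|(speed (6 * s + 5) k)%:~R * t - m%:~R| <= 6^-1 - (6 * p)^-1.
Proof.
move=> s1 p; apply: contrapT => far.
have p11 : 11 <= p.
  have : 1 <= s%:~R :> R by rewrite ler1z.
  by rewrite /p; lra.
have p0 : 0 < p by apply: lt_le_trans p11.
have h (k : 'I_6) (x : R) : (speed (6 * s + 5) k)%:~R * t = x ->
    p - 1 < 6 * p * (x - (Num.floor x)%:~R) < 5 * p + 1.
  move=> <-; apply: far_from_integers => // m.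
  by rewrite ltNge; apply/negP => le; apply: far; exists k, m.
pose X := 6 * t; pose Y := p * t.
have e0 := h (inord 0) X; have e1 := h (inord 1) (Y - 2 * X).
have e2 := h (inord 2) (Y - X); have e3 := h (inord 3) Y.
have e4 := h (inord 4) (Y + X); have e5 := h (inord 5) (2 * Y - X).
rewrite /speed !inordK//= ?(rmorphD, rmorphB, rmorphM)/= in e0 e1 e2 e3 e4 e5.
have {}e0 := e0 erefl.
have {}e1 := e1 ltac:(rewrite /Y /X /p; ring).
have {}e2 := e2 ltac:(rewrite /Y /X /p; ring).
have {}e3 := e3 ltac:(rewrite /Y /X /p; ring).
have {}e4 := e4 ltac:(rewrite /Y /X /p; ring).
have {}e5 := e5 ltac:(rewrite /Y /X /p; ring).
set i := Num.floor X in e0; set j := Num.floor Y in e3.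
have tr (a b : R) : a = b -> p - 1 < a < 5 * p + 1 -> p - 1 < b < 5 * p + 1 by move=> ->.
(* Floors are corrected for replacing X, Y by X - i, Y - j; as pX = 6Y, the lattice value p(X - i) -
   6(Y - j) is 6j - pi. *)
apply: (@no_lattice_point R s p (6 * p * (X - i%:~R)) (6 * p * (Y - j%:~R))
  (Num.floor (Y - 2 * X) - j + 2 * i) (Num.floor (Y - X) - j + i)
  (Num.floor (Y + X) - j - i) (Num.floor (2 * Y - X) - 2 * j + i)
  (6 * j - (6 * s + 5) * i)) => //.
- by apply: tr e1; rewrite !(rmorphD, rmorphN, rmorphM)/=; ring.
- by apply: tr e2; rewrite !(rmorphD, rmorphN, rmorphM)/=; ring.
- by apply: tr e4; rewrite !(rmorphD, rmorphN, rmorphM)/=; ring.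
- by apply: tr e5; rewrite !(rmorphD, rmorphN, rmorphM)/=; ring.
rewrite !(rmorphD, rmorphN, rmorphM)/=.
have -> : Y = p * X / 6 by rewrite /Y /X; field.
by rewrite /p; field.
Qed.

(* Chosen so that 6t = (s+1)/p and pt = 2/3 modulo 1, a vertex of one of the
   triangles. *)
Definition optimal_time (R : realType) (s : R) : R :=
  (2 / 3 + s ^+ 2 + 4 * s + 2) / (6 * s + 5).

Lemma optimal_time_speed (R : realType) (s : int) : 1 <= s ->
  let p : R := 6 * s%:~R + 5 in forall k, exists m : int,
  `|(speed (6 * s + 5) k)%:~R * optimal_time s%:~R - 2^-1 - m%:~R| <= 3^-1 + (6 * p)^-1.
Proof.
move=> s1 p k.
have s1R : 1 <= s%:~R :> R by rewrite ler1z.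
have p11 : 11 <= p by rewrite /p; lra.
have p0 : 0 < p by apply: lt_le_trans p11.
pose d : R := (6 * p)^-1.
have d0 : 0 < d by rewrite invr_gt0 mulr_gt0.
have d1 : d <= 66^-1 by rewrite lef_pV2 ?posrE ?mulr_gt0//; lra.
have pn0 : 6 * s%:~R + 5 != 0 :> R by rewrite gt_eqF.
have X : 6 * optimal_time s%:~R = 6^-1 + d + s%:~R + 3.
  by rewrite /optimal_time /d /p; field.
have Y : p * optimal_time s%:~R = 2 / 3 + s%:~R ^+ 2 + 4 * s%:~R + 2.
  by rewrite /optimal_time /p; field.
(* The integer parts of 6t and pt, which satisfy 6(b + 2/3) = pa + s + 1; the fractional part (s +
   1)/p of 6t equals 1/6 + d. *)
pose a : int := s + 3; pose b : int := s ^+ 2 + 4 * s + 2.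
have aE : a%:~R = s%:~R + 3 :> R by rewrite rmorphD.
have bE : b%:~R = s%:~R ^+ 2 + 4 * s%:~R + 2 :> R.
  by rewrite !rmorphD rmorphM rmorphXn.
have close (w : int) (c : R) (m : int) : w%:~R * optimal_time s%:~R - 2^-1 - m%:~R = c ->
    - (3^-1 + d) <= c -> c <= 3^-1 + d ->
    exists m : int, `|w%:~R * optimal_time s%:~R - 2^-1 - m%:~R| <= 3^-1 + d.
  by move=> e c1 c2; exists m; rewrite e ler_norml c1.
have pE : (6 * s + 5)%:~R = p by rewrite rmorphD rmorphM.
(* Offsets from 1/2 at (x, y) = (1/6 + d, 2/3). Only y + x and 2y - x, whose edges meet at this
   vertex, reach 1/3 + d in absolute value. *)
case: k => [[|[|[|[|[|[|//]]]]]] ki]; rewrite /speed /= {ki}.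
- by apply: (close _ (- 3^-1 + d) a); [rewrite aE X; lra|lra|lra].
- apply: (close _ (- 6^-1 - 2 * d) (b - 2 * a)); [|lra|lra].
  by rewrite !rmorphB/= pE rmorphM/= aE bE; nra.
- apply: (close _ (- d) (b - a)); [|lra|lra].
  by rewrite !rmorphB/= pE aE bE; nra.
- apply: (close _ (6^-1) b); [|lra|lra].
  by rewrite pE bE; lra.
- apply: (close _ (3^-1 + d) (b + a)); [|lra|lra].
  by rewrite intrD pE intrD aE bE; nra.
(* The extra 1 appears because 2y - x = 7/6 - d exceeds 1. *)
- apply: (close _ (- 3^-1 - d) (2 * b - a + 1)); [|lra|lra].
  by rewrite intrB intrM pE (intrD _ (_ - _)) intrB (intrM _ _ b) aE bE; nra.
Qed.

(** * Realising the values in the spectrum *)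

Theorem theorem1p5 (R : realType) :
  [set 3^-1 + (6 * p%:R)^-1 | p in Prog 6 11] `<=`
    spectrum R 1 6 `&` `]3^-1, 2^-1].
Proof.
move=> _ [_ [a _ <-] <-].
(* 6a + 11 = 6(a + 1) + 5. *)
pose s : int := a%:Z + 1; have s1 : 1 <= s by rewrite /s; lia.
have -> : (6 * a + 11)%:R = 6 * s%:~R + 5 :> R.
  by rewrite /s intrD -pmulrn (natrD _ (6 * a)) natrM; ring.
set v := 3^-1 + _.
have p11 : 11 <= 6 * s%:~R + 5 :> R.
  have : 1 <= s%:~R :> R by rewrite ler1z.
  by lra.
have p0 : 0 < 6 * s%:~R + 5 :> R by apply: lt_le_trans p11.
have d0 : 0 < (6 * (6 * s%:~R + 5))^-1 :> R by rewrite invr_gt0 mulr_gt0.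
have d1 : (6 * (6 * s%:~R + 5))^-1 <= 66^-1 :> R.
  by rewrite lef_pV2 ?posrE ?mulr_gt0//; lra.
split; last by rewrite /= in_itv /=; apply/andP; split; rewrite /v; lra.
pose w := speed (6 * s + 5).
have low t : v <= D (winding w (circle_pi t)).
  have [k [m h]] := near_integer t s1.
  by apply: (D_winding_ge (k := k) (m := m)); rewrite /v; lra.
pose t : R := optimal_time s%:~R.
have upp : D (winding w (circle_pi t)) <= v.
  by apply: D_winding_le; [rewrite /v; lra|exact: optimal_time_speed].
exists (range (@winding R 6 w)); split.
- split; first exact: winding_subtorus (speed_bezout s).
  (* The minimiser witnesses properness: a zero coordinate there would force [D] to be at least 1/2
     > [v]. *)
  move=> /(_ (winding w (circle_pi t))) [|k _ /=]; first by exists (circle_pi t).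
  rewrite /winding circle_pi_mulrz -(raddf0 (@circle_pi R)) => /circle_pi_eqP [m].
  rewrite add0r => e.
  have : 2^-1 <= D (winding w (circle_pi t)).
    by apply: (D_winding_ge (k := k) (m := m)); rewrite e !subrr normr0.
  by move=> /le_trans/(_ upp); rewrite /v; lra.
- exact: winding_dim1 (speed_bezout s).
- split; last by move=> _ [_ [y _ <-] <-]; rewrite -(circle_piK y).
  exists (winding w (circle_pi t)); first by exists (circle_pi t).
  by apply/eqP; rewrite eq_le upp low.
Qed.
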